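(* Let $\mathcal{H}$ be a Hilbert space, let $n\ge1$, let $\delta$ be a real number, and suppose $\mathsf{P}_1,\dots,\mathsf{P}_n$ are orthogonal projections with respect to the inner product of $\mathcal{H}$ satisfying $$\left\|\frac1n\sum_{i=1}^n\mathsf{P}_i\right\|_{\mathsf{op}}\le 1-\delta.$$ Then $$\|\mathsf{P}_n\cdots\mathsf{P}_1\|_{\mathsf{op}}\le 1-\frac{\delta}{8(n+1)}.$$
   Context: For a bounded linear operator $\mathsf{A}:\mathcal{H}\to\mathcal{H}$, $\|\mathsf{A}\|_{\mathsf{op}}=\sup_{f\in\mathcal{H},\,f\neq0}\|\mathsf{A}f\|/\|f\|$, where $\|\cdot\|$ is the norm induced by the inner product. *)

(* Defs.v *)
From mathcomp Require Import all_boot all_order all_algebra.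
From mathcomp Require Import all_classical all_reals all_analysis.
From mathcomp Require Import sesquilinear complex.

Set Implicit Arguments.
Unset Strict Implicit.
Unset Printing Implicit Defensive.

Import Order.TTheory GRing.Theory Num.Theory.

Local Open Scope classical_set_scope.
Local Open Scope ring_scope.

(* The two scalar fields of a Hilbert space. *)
Variant scalar_kind := RealScalar | ComplexScalar.

Definition scalar_field (R : realType) (k : scalar_kind) : numFieldType :=
  match k with
  | RealScalar => R
  | ComplexScalar => R[i]
  end.

Definition scalar_conj (R : realType) (k : scalar_kind) :
    scalar_field R k -> scalar_field R k :=
  match k return scalar_field R k -> scalar_field R k with
  | RealScalar => fun a => a
  | ComplexScalar => fun a : R[i] => conjc a
  end.

Definition scalar_Re (R : realType) (k : scalar_kind) : scalar_field R k -> R :=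
  match k return scalar_field R k -> R with
  | RealScalar => fun a => a
  | ComplexScalar => fun a : R[i] => complex.Re a
  end.

(* A Hilbert space is a complete normed module over [scalar_field R k] together with
   a positive definite hermitian form, linear in its first argument, that
   induces the norm. *)
Definition induces_norm (R : realType) (k : scalar_kind)
    (H : completeNormedModType (scalar_field R k))
    (dot : {dot H for @scalar_conj R k}) : Prop :=
  forall f : H, `|f| ^+ 2 = dot f f.

(* The library norm takes its values in the scalar field, so over the complex
   numbers [`|f|] is an element of [R[i]] with zero imaginary part. *)
Definition rnorm (R : realType) (k : scalar_kind)
    (H : completeNormedModType (scalar_field R k)) (f : H) : R :=
  scalar_Re `|f|.

(* Meaningful for bounded operators only: [sup] is 0 on sets that are not
   bounded above. It is also 0 on the empty set, so the operator norm is 0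
   when [H] is the zero space. *)
Definition opnorm (R : realType) (k : scalar_kind)
    (H : completeNormedModType (scalar_field R k)) (A : H -> H) : R :=
  sup [set rnorm (A f) / rnorm f | f in [set f : H | f != 0]].

(* For a linear map, continuity is boundedness: [linear_bounded_continuous]. *)
Definition orthogonal_projection (R : realType) (k : scalar_kind)
    (H : completeNormedModType (scalar_field R k))
    (dot : {dot H for @scalar_conj R k}) (P : {linear H -> H}) : Prop :=
  [/\ continuous P,
      forall f : H, P (P f) = P f
    & forall f g : H, dot (P f) g = dot f (P g)].

(* Main.v *)
Require Import Defs.
From mathcomp Require Import all_boot all_order all_algebra.
From mathcomp Require Import all_classical all_reals all_analysis.
From mathcomp Require Import sesquilinear complex.
From mathcomp Require Import ring lra.

Import Order.TTheory GRing.Theory Num.Theory.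

Local Open Scope ring_scope.

(** Fix [f], let [x] be its image under [P_n ... P_1], and call
    [D = |f|^2 - |x|^2] the energy lost along the way.  By Pythagoras [D] is the
    sum of the squared step lengths of the walk [f, P_1 f, P_2 P_1 f, ...], so by
    Cauchy-Schwarz the position after [i] steps is within [sqrt (i D)] of [f]
    ([sqr_displacement_le]).  That position lies in the range of [P_i], whose
    point nearest to [f] is [P_i f]; hence [|f - P_i f|^2 <= i D], and summing
    over [i] gives [\sum_i |f - P_i f|^2 <= n (n + 1) / 2 * D]
    ([sum_sqr_dist_le]).

    On the other hand [|f - P_i f|^2 = |f|^2 - <P_i f, f>], so the bound on the
    average of the projections gives [\sum_i |f - P_i f|^2 >= n delta |f|^2]
    ([sum_sqr_dist_ge]).  Therefore [D >= 2 delta / (n + 1) * |f|^2], that is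
    [|x|^2 <= (1 - 2 delta / (n + 1)) |f|^2], and since
    [1 - 2 t <= (1 - t)^2] this yields the contraction factor
    [1 - delta / (n + 1)], which is at most [1 - delta / (8 (n + 1))] when
    [0 <= delta].  For negative [delta] the claim is only that a product of
    projections does not increase the norm. *)

(** * Real parts of scalars *)

Section ScalarRe.
Context {R : realType} {k : scalar_kind}.
Implicit Types a b : scalar_field R k.

Lemma scalar_ReD a b : scalar_Re (a + b) = scalar_Re a + scalar_Re b.
Proof. by case: k a b => // -[a1 a2] [b1 b2]. Qed.

Lemma scalar_ReN a : scalar_Re (- a) = - scalar_Re a.
Proof. by case: k a => // -[a1 a2]. Qed.

Lemma scalar_Re0 : scalar_Re (0 : scalar_field R k) = 0.
Proof. by case: k. Qed.

Lemma scalar_ReMn a m : scalar_Re (a *+ m) = scalar_Re a *+ m.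
Proof. by elim: m => [|m IHm]; rewrite ?scalar_Re0// !mulrS scalar_ReD IHm. Qed.

Lemma scalar_Re_conj a : scalar_Re (scalar_conj a) = scalar_Re a.
Proof. by case: k a => // -[a1 a2]. Qed.

Lemma ler_scalar_Re a b : a <= b -> scalar_Re a <= scalar_Re b.
Proof. by case: k a b => //= a b; rewrite lecE => /andP[]. Qed.

Lemma ltr_scalar_Re a b : a < b -> scalar_Re a < scalar_Re b.
Proof. by case: k a b => //= a b; rewrite ltcE => /andP[]. Qed.

Lemma scalar_Re_sqr a : 0 <= a -> scalar_Re (a ^+ 2) = scalar_Re a ^+ 2.
Proof.
case: k a => //= -[a1 a2]; rewrite lecE /= => /andP[/eqP -> _].
by rewrite !expr2 /= mulr0 subr0.
Qed.

End ScalarRe.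

(** * The real norm and the operator norm *)

Section RealNorm.
Set Implicit Arguments.
Unset Strict Implicit.
Context {R : realType} {k : scalar_kind}.
Context {H : completeNormedModType (scalar_field R k)}.
Implicit Types (f g : H) (A : H -> H).

Lemma rnorm_ge0 f : 0 <= rnorm f.
Proof. by rewrite -(@scalar_Re0 R k) ler_scalar_Re. Qed.

Lemma rnorm_gt0 f : f != 0 -> 0 < rnorm f.
Proof. by move=> f0; rewrite -(@scalar_Re0 R k) ltr_scalar_Re// normr_gt0. Qed.

Lemma rnorm0 : rnorm (0 : H) = 0.
Proof. by rewrite /rnorm normr0 scalar_Re0. Qed.

Lemma ler_rnormD f g : rnorm (f + g) <= rnorm f + rnorm g.
Proof. by rewrite -scalar_ReD ler_scalar_Re// ler_normD. Qed.

Lemma rnormMn f m : rnorm (f *+ m) = rnorm f *+ m.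
Proof. by rewrite /rnorm normrMn scalar_ReMn. Qed.

Lemma opnorm_ge0 A : 0 <= opnorm A.
Proof.
rewrite /opnorm; set S := (X in sup X).
have [hS|noS] := pselect (has_sup S); last by rewrite sup_out.
have [[_ [f f0 _]] _] := hS.
apply: (@le_trans _ _ (rnorm (A f) / rnorm f)).
  by rewrite divr_ge0 ?rnorm_ge0.
by apply: sup_upper_bound => //; exists f.
Qed.

(** Some a priori bound [c] has to certify that the quotients are bounded:
    otherwise their supremum is the junk value 0 and bounds nothing. *)
Lemma rnorm_le_opnorm A c f : A 0 = 0 ->
  (forall g, rnorm (A g) <= c * rnorm g) -> rnorm (A f) <= opnorm A * rnorm f.
Proof.
move=> A0 Ac; have [->|f0] := eqVneq f 0; first by rewrite A0 rnorm0 mulr0.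
rewrite -ler_pdivrMr ?rnorm_gt0//; apply: ub_le_sup; last by exists f.
by exists c => _ [g g0 <-]; rewrite ler_pdivrMr ?rnorm_gt0.
Qed.

Lemma opnorm_le A c : 0 <= c ->
  (forall f, rnorm (A f) <= c * rnorm f) -> opnorm A <= c.
Proof.
move=> c0 Ac; rewrite /opnorm; set S := (X in sup X).
have [S0|/set0P/negP/negPn/eqP ->] := pselect (S !=set0)%classic.
  by apply: ge_sup => // _ [g g0 <-]; rewrite ler_pdivrMr ?rnorm_gt0.
by rewrite sup0.
Qed.

End RealNorm.

(** * Orthogonal projections *)

(** The real part of the hermitian form makes the space a real inner product
    space with the same norm, which treats both scalar fields at once. *)
Definition rdot {R : realType} {k : scalar_kind}
    {H : completeNormedModType (scalar_field R k)}
    (dot : {dot H for @scalar_conj R k}) (f g : H) : R :=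
  scalar_Re (dot f g).

Section Projections.
Set Implicit Arguments.
Unset Strict Implicit.
Context {R : realType} {k : scalar_kind}.
Context {H : completeNormedModType (scalar_field R k)}.
Context {dot : {dot H for @scalar_conj R k}} (Hdot : induces_norm dot).
Implicit Types (f g h : H) (Q : {linear H -> H}).

Local Notation B := (rdot dot).

Lemma rdotDl f g h : B (f + g) h = B f h + B g h.
Proof. by rewrite /rdot linearDl scalar_ReD. Qed.

Lemma rdotNl f h : B (- f) h = - B f h.
Proof. by rewrite /rdot linearNl scalar_ReN. Qed.

Lemma rdotC f g : B f g = B g f.
Proof.
by rewrite /rdot (@hermitian_subproof _ _ _ _ dot) expr0 mul1r scalar_Re_conj.
Qed.

Lemma rdotDr f g h : B f (g + h) = B f g + B f h.
Proof. by rewrite rdotC rdotDl !(rdotC f). Qed.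

Lemma rdotNr f g : B f (- g) = - B f g.
Proof. by rewrite rdotC rdotNl rdotC. Qed.

Lemma rdot_suml (I : Type) (r : seq I) (F : I -> H) g :
  B (\sum_(i <- r) F i) g = \sum_(i <- r) B (F i) g.
Proof.
elim: r => [|i r IHr]; last by rewrite !big_cons rdotDl IHr.
by rewrite !big_nil /rdot linear0l scalar_Re0.
Qed.

Lemma sqr_rnorm f : rnorm f ^+ 2 = B f f.
Proof. by rewrite /rdot -Hdot scalar_Re_sqr. Qed.

(** Squaring the triangle inequality and cancelling the two squares leaves
    Cauchy-Schwarz. *)
Lemma rdot_le f g : B f g <= rnorm f * rnorm g.
Proof.
have : rnorm (f + g) ^+ 2 <= (rnorm f + rnorm g) ^+ 2.
  by rewrite ler_sqr ?nnegrE ?addr_ge0 ?rnorm_ge0// ler_rnormD.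
rewrite sqr_rnorm sqrrD !sqr_rnorm !rdotDl !rdotDr (rdotC g f); lra.
Qed.

Lemma rdot_proj Q f g : orthogonal_projection dot Q ->
  B (Q f) (Q g) = B (Q f) g.
Proof. by case=> _ idQ symQ; rewrite /rdot -symQ idQ. Qed.

Lemma proj_pythagoras Q f : orthogonal_projection dot Q ->
  rnorm f ^+ 2 = rnorm (Q f) ^+ 2 + rnorm (f - Q f) ^+ 2.
Proof.
move=> oQ; rewrite !sqr_rnorm !(rdotDl, rdotDr, rdotNl, rdotNr).
rewrite (rdotC f (Q f)) !rdot_proj//; lra.
Qed.

Lemma rnorm_proj_le Q f : orthogonal_projection dot Q -> rnorm (Q f) <= rnorm f.
Proof.
move=> oQ; rewrite -ler_sqr ?nnegrE ?rnorm_ge0//.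
by rewrite (proj_pythagoras f oQ) lerDl sqr_ge0.
Qed.

(** [f - Q g] is the sum of the orthogonal vectors [f - Q f] and [Q (f - g)]:
    they are the two components of [f - Q g] in the decomposition along [Q]. *)
Lemma proj_nearest Q f g : orthogonal_projection dot Q ->
  rnorm (f - Q f) ^+ 2 <= rnorm (f - Q g) ^+ 2.
Proof.
move=> oQ; have [_ idQ _] := oQ.
rewrite (proj_pythagoras (f - Q g) oQ) linearB idQ.
have -> : f - Q g - (Q f - Q g) = f - Q f by rewrite opprB addrA subrK.
by rewrite lerDr sqr_ge0.
Qed.

(** * The walk through the projections *)

Definition prod_proj n (P : 'I_n -> {linear H -> H}) : H -> H :=
  \big[@comp H H H/idfun]_(i < n) (P (rev_ord i) : H -> H).

Definition init_proj n (P : 'I_n.+1 -> {linear H -> H}) (i : 'I_n) :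
    {linear H -> H} := P (widen_ord (leqnSn n) i).

Lemma prod_projS n (P : 'I_n.+1 -> {linear H -> H}) f :
  prod_proj P f = P ord_max (prod_proj (init_proj P) f).
Proof.
rewrite /prod_proj big_ord_recl /=.
have -> : rev_ord ord0 = ord_max :> 'I_n.+1 by apply: val_inj; rewrite /= subn1.
congr (P _ (_ f)); apply: eq_bigr => i _; rewrite /init_proj.
have -> // : rev_ord (lift ord0 i) = widen_ord (leqnSn n) (rev_ord i).
by apply: val_inj; rewrite /= subSS.
Qed.

Definition energy_loss n (P : 'I_n -> {linear H -> H}) f : R :=
  rnorm f ^+ 2 - rnorm (prod_proj P f) ^+ 2.

Lemma energy_lossS n (P : 'I_n.+1 -> {linear H -> H}) f :
  orthogonal_projection dot (P ord_max) ->
  energy_loss P f = energy_loss (init_proj P) f +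
    rnorm (prod_proj (init_proj P) f - prod_proj P f) ^+ 2.
Proof.
move=> oP; rewrite /energy_loss prod_projS.
rewrite (proj_pythagoras (prod_proj (init_proj P) f) oP); ring.
Qed.

Lemma prod_proj0 (P : 'I_0 -> {linear H -> H}) f : prod_proj P f = f.
Proof. by rewrite /prod_proj big_ord0. Qed.

Lemma energy_loss_ge0 n (P : 'I_n -> {linear H -> H}) f :
  (forall i, orthogonal_projection dot (P i)) -> 0 <= energy_loss P f.
Proof.
elim: n P => [|n IHn] P oP; first by rewrite /energy_loss prod_proj0 subrr.
by rewrite energy_lossS// addr_ge0 ?sqr_ge0// IHn// => i; apply: oP.
Qed.

(** One step of the Cauchy-Schwarz inequality for a sum of [m + 1] reals, with
    the squares of the first [m] of them replaced by their sum [D]. *)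
Lemma sqrD_le_succ (m D a d : R) : 0 <= m -> 0 <= D -> a ^+ 2 <= m * D ->
  (a + d) ^+ 2 <= (m + 1) * (D + d ^+ 2).
Proof.
move=> m0 D0 aD.
suff : 2 * (a * d) <= D + m * d ^+ 2 by nra.
have E0 : 0 <= D + m * d ^+ 2 by rewrite addr_ge0// mulr_ge0// sqr_ge0.
(* After squaring, [4 a^2 d^2 <= 4 (m d^2) D <= (D + m d^2)^2]. *)
apply: le_trans (ler_norm _) _.
rewrite -ler_sqr ?nnegrE// -normrX ger0_norm ?sqr_ge0//.
have : a ^+ 2 * d ^+ 2 <= m * D * d ^+ 2 by rewrite ler_wpM2r ?sqr_ge0.
have := sqr_ge0 (D - m * d ^+ 2); nra.
Qed.

Lemma sqr_displacement_le n (P : 'I_n -> {linear H -> H}) f :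
  (forall i, orthogonal_projection dot (P i)) ->
  rnorm (f - prod_proj P f) ^+ 2 <= n%:R * energy_loss P f.
Proof.
elim: n P => [|n IHn] P oP.
  by rewrite prod_proj0 subrr rnorm0 mul0r expr0n.
have oP' i : orthogonal_projection dot (init_proj P i) by apply: oP.
rewrite energy_lossS// -natr1.
apply: le_trans; last first.
  by apply: sqrD_le_succ (IHn _ oP'); rewrite ?energy_loss_ge0.
rewrite ler_sqr ?nnegrE ?addr_ge0 ?rnorm_ge0//.
by apply: le_trans (ler_rnormD _ _); rewrite addrA subrK.
Qed.

(** The factor [n (n + 1) / 2] is the sum of the bounds [i D] of
    [sqr_displacement_le] over the positions [i = 1, ..., n] of the walk. *)
Lemma sum_sqr_dist_le n (P : 'I_n -> {linear H -> H}) f :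
  (forall i, orthogonal_projection dot (P i)) ->
  2 * \sum_(i < n) rnorm (f - P i f) ^+ 2
    <= n%:R * (n%:R + 1) * energy_loss P f.
Proof.
elim: n P => [|n IHn] P oP; first by rewrite big_ord0 mulr0 !mul0r.
have oP' i : orthogonal_projection dot (init_proj P i) by apply: oP.
rewrite big_ord_recr /=; have {IHn} := IHn _ oP'.
have := proj_nearest f (prod_proj (init_proj P) f) (oP ord_max).
rewrite -prod_projS; have := sqr_displacement_le f oP.
rewrite energy_lossS// -natr1 /init_proj.
have := sqr_ge0 (rnorm (prod_proj (init_proj P) f - prod_proj P f)).
have := ler0n R n; rewrite /init_proj.
move: (\sum_(i < n) _) (n%:R) => s m.
move: (rnorm _ ^+ 2) (energy_loss _ _) (rnorm _ ^+ 2) (rnorm _ ^+ 2).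
move=> d D e r; nra.
Qed.

Lemma sum_sqr_dist_ge n (P : 'I_n -> {linear H -> H}) f (c : R) :
  (forall i, orthogonal_projection dot (P i)) ->
  rnorm (\sum_(i < n) P i f) <= n%:R * c * rnorm f ->
  n%:R * (1 - c) * rnorm f ^+ 2 <= \sum_(i < n) rnorm (f - P i f) ^+ 2.
Proof.
move=> oP sumP.
have distE i : rnorm (f - P i f) ^+ 2 = rnorm f ^+ 2 - B (P i f) f.
  rewrite (proj_pythagoras f (oP i)) (sqr_rnorm (P i f)) rdot_proj//; ring.
under eq_bigr do rewrite distE.
rewrite big_split /= sumrN -rdot_suml sumr_const card_ord -mulr_natl.
have := rdot_le (\sum_(i < n) P i f) f.
have : rnorm (\sum_(i < n) P i f) * rnorm f <= n%:R * c * rnorm f * rnorm f.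
  by rewrite ler_wpM2r ?rnorm_ge0.
lra.
Qed.

End Projections.

Theorem corollary3p1 (R : realType) (k : scalar_kind)
    (H : completeNormedModType (scalar_field R k))
    (dot : {dot H for @scalar_conj R k}) (Hdot : induces_norm dot)
    (n : nat) (n_ge1 : (1 <= n)%N) (delta : R)
    (P : 'I_n -> {linear H -> H})
    (HP : forall i : 'I_n, orthogonal_projection dot (P i)) :
  opnorm (fun f : H => n%:R^-1 *: \sum_(i < n) P i f) <= 1 - delta ->
  opnorm (\big[@comp H H H/idfun]_(i < n) (P (rev_ord i) : H -> H))
    <= 1 - delta / (8 * (n%:R + 1)).
Proof.
set A := (fun f : H => _) => opA.
have c_ge0 : 0 <= 1 - delta := le_trans (opnorm_ge0 A) opA.
have n_gt0 : 0 < n%:R :> R by rewrite ltr0n.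
have AMn f : A f *+ n = \sum_(i < n) P i f.
  by rewrite -scaler_nat scalerA divff ?scale1r// pnatr_eq0 -lt0n.
have rnormA f : n%:R * rnorm (A f) = rnorm (\sum_(i < n) P i f).
  by rewrite -AMn rnormMn mulr_natl.
(* An average of contractions is a contraction; this makes [opnorm A] an
   actual bound for [A]. *)
have A_le f : rnorm (A f) <= 1 * rnorm f.
  rewrite -(ler_pM2l n_gt0) rnormA mul1r.
  have sum_le : rnorm (\sum_(i < n) P i f) <= \sum_(i < n) rnorm (P i f).
    elim/big_ind2 : _ => [|x a y b xa yb|//]; first by rewrite rnorm0.
    exact: le_trans (ler_rnormD _ _) (lerD xa yb).
  apply: le_trans sum_le _.
  have -> : n%:R * rnorm f = \sum_(i < n) rnorm f.
    by rewrite sumr_const card_ord mulr_natl.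
  by apply: ler_sum => i _; apply: rnorm_proj_le (HP i).
have A0 : A 0 = 0.
  by rewrite /A big1 ?scaler0// => i _; rewrite raddf0.
have loss_ge f :
    2 * delta * rnorm f ^+ 2 <= (n%:R + 1) * energy_loss P f.
  have sum_le : rnorm (\sum_(i < n) P i f) <= n%:R * (1 - delta) * rnorm f.
    rewrite -rnormA -mulrA ler_pM2l//.
    apply: le_trans (rnorm_le_opnorm f A0 A_le) _.
    by rewrite ler_wpM2r ?rnorm_ge0.
  rewrite -(ler_pM2l n_gt0).
  have := sum_sqr_dist_ge Hdot HP sum_le.
  have := sum_sqr_dist_le Hdot f HP; lra.
have n1_gt0 : 0 < n%:R + 1 :> R by rewrite addr_gt0.
set t := delta / (n%:R + 1).
have tE : delta = t * (n%:R + 1) by rewrite /t divfK// gt_eqF.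
have t_le1 : t <= 1.
  rewrite /t ler_pdivrMr// mul1r; lra.
have -> : delta / (8 * (n%:R + 1)) = t / 8.
  by rewrite /t invfM mulrA mulrAC.
rewrite -[X in opnorm X]/(prod_proj P).
apply: opnorm_le => [|f]; first by lra.
have prod_le : rnorm (prod_proj P f) <= 1 * rnorm f.
  rewrite mul1r -ler_sqr ?nnegrE ?rnorm_ge0// -subr_ge0.
  exact: energy_loss_ge0 HP.
have [t_ge0|t_lt0] := leP 0 t; last first.
  apply: le_trans prod_le _; rewrite ler_wpM2r ?rnorm_ge0//; lra.
have sharp : rnorm (prod_proj P f) <= (1 - t) * rnorm f.
  have u_ge0 : 0 <= 1 - t by rewrite subr_ge0.
  rewrite -ler_sqr ?nnegrE ?mulr_ge0 ?rnorm_ge0// exprMn.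
  have : 2 * t * rnorm f ^+ 2 <= energy_loss P f.
    by rewrite -(ler_pM2l n1_gt0); have := loss_ge f; rewrite {1}tE; lra.
  rewrite /energy_loss; have := sqr_ge0 (t * rnorm f); lra.
apply: le_trans sharp _; rewrite ler_wpM2r ?rnorm_ge0//; lra.
Qed.
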